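(* Let $A,D\in\mathbb{B}(\mathcal{H})$ and $T=\begin{bmatrix}A&0\\0&D\end{bmatrix}\in\mathbb{B}(\mathcal{H}\oplus\mathcal{H})$. Let $f,g$ be non-negative continuous functions on $[0,\infty)$ with $f(t)g(t)=t$ for all $t\ge0$. Then for every non-negative, nondecreasing, convex function $h$ on $[0,\infty)$, \[ h(w(T))\le \frac12\max\left(\left\|h\big(f^2(|A|)\big)+h\big(g^2(|A|)\big)\right\|,\ \left\|h\big(f^2(|D|)\big)+h\big(g^2(|D|)\big)\right\|\right). \]
   Context: $\mathcal{H}$ is a complex Hilbert space; $w(X)=\sup\{|\langle Xx,x\rangle|:\|x\|=1\}$ is the numerical radius; $|X|=(X^*X)^{1/2}$; functions of positive operators are defined by continuous functional calculus, $f^2(|A|)=(f(|A|))^2$; $\|\cdot\|$ is the operator norm. *)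

(* Defs.v *)
(* + MathComp-Analysis (realType, sup, continuity) +
   mathcomp-real-closed complex numbers R[i]. *)
From HB Require Import structures.
From mathcomp Require Import all_boot all_order all_algebra.
From mathcomp Require Import all_classical all_reals.
From mathcomp Require Import topology normedtype.
From mathcomp Require Import complex.
Set Implicit Arguments. Unset Strict Implicit. Unset Printing Implicit Defensive.
Import Order.TTheory GRing.Theory Num.Theory.
Import numFieldNormedType.Exports.
Local Open Scope ring_scope.
Local Open Scope classical_set_scope.

Section HilbertDefs.
Variable R : realType.
Local Notation C := R[i].

(* modulus of a complex number, as a real number *)
Definition cabs (z : C) : R := @complex.Re R `|z|.

Variable V : lmodType C.
Variable ip : V -> V -> C.   (* inner product <x, y>, linear in x *)

(* complex inner product axioms *)
Definition is_inner_product : Prop :=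
  [/\ (forall (a : C) (x y z : V), ip (a *: x + y) z = a * ip x z + ip y z),
      (forall x y : V, ip y x = ((ip x y)^*)%C),
      (forall x : V, 0 <= ip x x) &
      (forall x : V, ip x x = 0 -> x = 0)].

(* induced norm ||x|| = sqrt <x, x> *)
Definition vnorm (x : V) : R := Num.sqrt (@complex.Re R (ip x x)).

(* completeness of V for the induced norm *)
Definition is_complete : Prop :=
  forall u : nat -> V,
    (forall e : R, 0 < e -> exists N : nat, forall m n : nat,
         (N <= m)%N -> (N <= n)%N -> vnorm (u m - u n) < e) ->
    exists l : V, forall e : R, 0 < e -> exists N : nat, forall n : nat,
         (N <= n)%N -> vnorm (u n - l) < e.

(* a complex Hilbert space *)
Definition is_Hilbert : Prop := is_inner_product /\ is_complete.

(* bounded (= continuous) linear operators : elements of B(H) *)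
Definition bounded_linear (A : V -> V) : Prop :=
  (forall (a : C) (x y : V), A (a *: x + y) = a *: A x + A y) /\
  exists M : R, forall x : V, vnorm (A x) <= M * vnorm x.

(* B is the Hilbert-space adjoint A^* of A *)
Definition is_adjoint (A B : V -> V) : Prop :=
  forall x y : V, ip (A x) y = ip x (B y).

(* operator norm ||A|| = sup { ||A x|| : ||x|| <= 1 } *)
Definition opnorm (A : V -> V) : R :=
  sup [set vnorm (A x) | x in [set x : V | vnorm x <= 1]].

(* numerical radius of T = A (+) D on H (+) H:
   w(T) = sup { |<T(x,y),(x,y)>| : ||x||^2 + ||y||^2 = 1 }
        = sup { |<A x, x> + <D y, y>| : ||x||^2 + ||y||^2 = 1 } *)
Definition numrad_diag (A D : V -> V) : R :=
  sup [set cabs (ip (A xy.1) xy.1 + ip (D xy.2) xy.2) |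
       xy in [set xy : V * V | vnorm xy.1 ^+ 2 + vnorm xy.2 ^+ 2 = 1]].

(* p(P) for a real polynomial p and an operator P *)
Definition poly_op (p : {poly R}) (P : V -> V) : V -> V :=
  fun x => \sum_(i < size p) ((p`_i)%:C)%C *: iter i P x.

(* Continuous functional calculus for a positive operator P.
   [is_funcalc phi P B] means B = phi(P).  For positive P (spectrum contained
   in [0, ||P||]) and phi continuous on [0, ||P||], phi(P) is the unique bounded
   operator B with ||p(P) - B|| <= sup_{t in [0,||P||]} |p(t) - phi(t)| for every
   real polynomial p (uniqueness by Weierstrass approximation; the inequality
   holds for phi(P) since ||(p - phi)(P)|| = sup over the spectrum of |p - phi|). *)
Definition is_funcalc (phi : R -> R) (P B : V -> V) : Prop :=
  bounded_linear B /\
  forall p : {poly R},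
    opnorm (fun x => poly_op p P x - B x) <=
    sup [set `|p.[t] - phi t| | t in `[0, opnorm P]].

(* positive operator *)
Definition positive_op (P : V -> V) : Prop :=
  bounded_linear P /\ forall x : V, 0 <= ip (P x) x.

End HilbertDefs.

(* properties of the scalar functions on [0, oo) *)
Definition nonneg_on_pos (R : realType) (f : R -> R) : Prop :=
  forall t : R, 0 <= t -> 0 <= f t.

Definition nondecreasing_on_pos (R : realType) (f : R -> R) : Prop :=
  forall s t : R, 0 <= s -> s <= t -> f s <= f t.

Definition convex_on_pos (R : realType) (f : R -> R) : Prop :=
  forall (s t l : R), 0 <= s -> 0 <= t -> 0 <= l -> l <= 1 ->
    f (l * s + (1 - l) * t) <= l * f s + (1 - l) * f t.

(* Main.v *)
(* Put a = ||A||.  Unit vectors u_n with ||A u_n|| -> a satisfy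
   A^*A u_n - a^2 u_n -> 0.  Approximate eigenvectors pass through the
   functional calculus (clear for polynomials, then by Weierstrass
   approximation), so the same u_n serve |A| at a, then f^2(|A|) at f(a)^2 and
   g^2(|A|) at g(a)^2, and finally h(f^2(|A|)) + h(g^2(|A|)) at
   h(f(a)^2) + h(g(a)^2).  The norm of this last operator is therefore at least
   h(f(a)^2) + h(g(a)^2), which dominates 2 h(f(a) g(a)) = 2 h(a) by convexity
   and the AM-GM inequality.  It remains to note that
   w(T) <= max(||A||, ||D||). *)
Require Import Defs.
From HB Require Import structures.
From mathcomp Require Import all_boot all_order all_algebra.
From mathcomp Require Import all_classical all_reals.
From mathcomp Require Import topology normedtype.
From mathcomp Require Import complex.
From mathcomp Require Import sequences derive realfun.
From mathcomp Require Import ring lra.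
Import Order.TTheory GRing.Theory Num.Theory.
Import numFieldNormedType.Exports.
Local Open Scope ring_scope.
Local Open Scope classical_set_scope.

(** * Weierstrass approximation by Bernstein polynomials *)

Section Weierstrass.
Variable R : realType.
Implicit Types (F G : nat -> R) (phi : R -> R).

(* Bernstein polynomial of the values [F 0, .., F n], by conditioning on the
   first of [n] Bernoulli trials: its value at [x] is the mean of [F k] when
   [k] is binomial with parameters [n] and [x]. *)
Fixpoint bernstein (n : nat) (F : nat -> R) : {poly R} :=
  if n is m.+1 then
    'X * bernstein m (fun k => F k.+1) + (1 - 'X) * bernstein m F
  else (F 0%N)%:P.

Lemma horner_bernsteinS n F (x : R) :
  (bernstein n.+1 F).[x] =
  x * (bernstein n (fun k => F k.+1)).[x] + (1 - x) * (bernstein n F).[x].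
Proof. by rewrite /= !hornerE. Qed.

Lemma le_bernstein n F G (x : R) : 0 <= x <= 1 ->
  (forall k, (k <= n)%N -> F k <= G k) ->
  (bernstein n F).[x] <= (bernstein n G).[x].
Proof.
move=> x01; elim: n F G => [|n IH] F G FG; first by rewrite !hornerC FG.
rewrite !horner_bernsteinS; apply: lerD; apply: ler_wpM2l; try lra.
  by apply: IH => k kn; exact: FG.
by apply: IH => k kn; apply: FG; exact: leqW.
Qed.

Lemma bernstein_affine n F (a b x : R) :
  (bernstein n (fun k => a + b * F k)).[x] = a + b * (bernstein n F).[x].
Proof.
elim: n F => [|n IH] F; first by rewrite !hornerC.
by rewrite !horner_bernsteinS !IH; ring.
Qed.

(** Squared bias plus variance of a binomial variable with parameters [n] and [x]. The centre [c] is
    arbitrary because conditioning on a successful first trial shifts it to [c - 1]. *)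
Lemma bernstein_sqr n (c x : R) :
  (bernstein n (fun k => (k%:R - c) ^+ 2)).[x] =
  (n%:R * x - c) ^+ 2 + n%:R * (x * (1 - x)).
Proof.
elim: n c => [|n IH] c; first by rewrite hornerC; ring.
rewrite horner_bernsteinS.
have -> : (fun k => (k.+1%:R - c) ^+ 2) = (fun k => (k%:R - (c - 1)) ^+ 2).
  by apply/funext => k; rewrite -(natr1 k); ring.
by rewrite !IH -(natr1 n); ring.
Qed.

(* Uniform continuity in the form to which the variance of the binomial law,
   [bernstein_sqr], applies. *)
Lemma quadratic_modulus phi (b : R) : 0 <= b ->
  {within `[0, b], continuous phi} -> forall e, 0 < e ->
  exists2 K, 0 <= K & forall s t, s \in `[0, b]%R -> t \in `[0, b]%R ->
    `|phi s - phi t| <= e + K * (s - t) ^+ 2.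
Proof.
move=> b0 cphi e e0.
have [M M0 phiM] : exists2 M, 0 <= M &
    forall t, t \in `[0, b]%R -> `|phi t| <= M.
  have [c _ cmax] := EVT_max b0 cphi; have [d _ dmin] := EVT_min b0 cphi.
  exists (`|phi c| + `|phi d|); first by rewrite addr_ge0.
  move=> t tb; move: (cmax t tb) (dmin t tb) => h1 h2.
  have := ler_norm (phi c); have := ler_norm (- phi d); rewrite normrN.
  have := normr_ge0 (phi c); have := normr_ge0 (phi d).
  by rewrite ler_norml; lra.
(* Compactness in covering form: a [d] that works near each point yields one [d] for the whole
   segment. *)
have /compact_near_coveringP/near_covering_withinP cov :=
  @segment_compact R 0 b.
have [d d0 dP] : exists2 d, 0 < d &
    forall s t, s \in `[0, b]%R -> t \in `[0, b]%R ->
    `|s - t| < d -> `|phi s - phi t| <= e.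
  near (0:R)^'+ => d; exists d => // s t sb tb std.
  move: t tb s sb std; near: d; apply: cov => x xb.
  have /subspace_continuousP/(_ x xb)/cvgrPdist_le/(_ (e / 2)) := cphi.
  rewrite divr_gt0 // => /(_ isT); rewrite near_withinE => -[r /= r0 rP].
  (* Half radii: [t] within [r / 2] of [x] and [s] within [d < r / 2] of [t] both lie within [r] of
     [x]. *)
  exists (ball x (r / 2), [set d | d < r / 2]).
    split=> /=; first by apply: nbhsx_ballx; rewrite divr_gt0.
    by apply: nbhs_right_lt; rewrite divr_gt0.
  move=> [t d] /= [xt dr] tb s sb std.
  have {}xt : `|x - t| < r / 2 := xt.
  have h1 := rP t; have h2 := rP s; rewrite /= in h1 h2.
  have {}h1 : `|phi x - phi t| <= e / 2.
    by apply: h1 => //; rewrite /ball_ /=; lra.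
  have {}h2 : `|phi x - phi s| <= e / 2.
    apply: h2 => //; rewrite /ball_ /=.
    have := ler_distD t x s; rewrite (distrC t s); lra.
  have := ler_distD (phi x) (phi s) (phi t); rewrite (distrC _ (phi x)); lra.
have K0 : 0 <= (M + M) / d ^+ 2 by apply: divr_ge0; [lra | exact: sqr_ge0].
(* Points at distance at least [d] have [(s - t) ^+ 2 / d ^+ 2 >= 1], so the quadratic term alone
   absorbs the crude bound [M + M]. *)
exists ((M + M) / d ^+ 2) => // s t sb tb; have [std|dst] := ltP `|s - t| d.
  by apply: le_trans (dP _ _ sb tb std) _; rewrite lerDl mulr_ge0 ?sqr_ge0.
apply: (@le_trans _ _ (M + M)).
  by apply: le_trans (ler_normB _ _) _; apply: lerD; exact: phiM.
have : 1 <= (s - t) ^+ 2 / d ^+ 2.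
  rewrite ler_pdivlMr ?exprn_gt0 // mul1r -(real_normK (num_real (s - t))).
  by rewrite ler_sqr ?nnegrE ?normr_ge0 ?(ltW d0).
rewrite mulrAC -mulrA => h1.
have : (M + M) * 1 <= (M + M) * ((s - t) ^+ 2 / d ^+ 2).
  by apply: ler_wpM2l => //; lra.
by rewrite mulr1; lra.
Unshelve. all: by end_near. Qed.

(** The quadratic modulus encloses the node values between affine functions of [(k - N x) ^+ 2].
    Bernstein means preserve this order and turn the square into the variance [N x (1 - x)], so the
    error is at most [e / 2 + K b ^+ 2 / N]. *)
Lemma weierstrass phi (b e : R) : 0 <= b ->
  {within `[0, b], continuous phi} -> 0 < e ->
  exists p : {poly R}, forall t, t \in `[0, b]%R -> `|p.[t] - phi t| <= e.
Proof.
(* The case [b = 0] is separate because the rescaling to [[0, 1]] divides by [b]. *)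
rewrite le_eqVlt => /predU1P[<- _ e0|b0 cphi e0].
  exists (phi 0)%:P => t; rewrite in_itv /= -eq_le => /eqP <-.
  by rewrite hornerC subrr normr0 ltW.
have [K K0 KP] :=
  quadratic_modulus phi b (ltW b0) cphi (e / 2) (divr_gt0 e0 (ltr0Sn _ 1)).
have [n nK] : exists n : nat, K * b ^+ 2 / (e / 2) < n.+1%:R.
  have c0 : 0 <= K * b ^+ 2 / (e / 2).
    by apply: divr_ge0; [rewrite mulr_ge0 ?sqr_ge0 | lra].
  exists (Num.bound (K * b ^+ 2 / (e / 2))).
  by apply: lt_trans (archi_boundP c0) _; rewrite ltr_nat.
set N : R := n.+1%:R.
have N0 : 0 < N by rewrite ltr0Sn.
pose F k := phi (b * (k%:R / N)).
exists (bernstein n.+1 F \Po (b^-1 *: 'X)) => t tb.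
have /andP[t0 tlb] : 0 <= t <= b by move: tb; rewrite in_itv.
rewrite horner_comp hornerZ hornerX; set x := b^-1 * t.
have x01 : 0 <= x <= 1.
  by rewrite /x mulrC ler_pdivrMr // mul1r tlb divr_ge0 // ltW.
have tx : t = b * x by rewrite /x mulrA divff ?mul1r // gt_eqF.
have Fk k : (k <= n.+1)%N ->
  `|F k - phi t| <= e / 2 + K * b ^+ 2 / N ^+ 2 * (k%:R - N * x) ^+ 2.
  move=> kn.
  have kb : b * (k%:R / N) \in `[0, b]%R.
    rewrite in_itv /= mulr_ge0 ?divr_ge0 ?(ltW b0) ?(ltW N0) //=.
    by rewrite ger_pMr // ler_pdivrMr // mul1r ler_nat.
  apply: le_trans (KP _ _ kb tb) _; rewrite lerD2l {1}tx.
  rewrite le_eqVlt; apply/orP; left; apply/eqP.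
  by field; rewrite nat1r pnatr_eq0.
have sq : (bernstein n.+1 (fun k => (k%:R - N * x) ^+ 2)).[x] =
    N * (x * (1 - x)).
  by rewrite bernstein_sqr -/N subrr expr0n add0r.
have err : K * b ^+ 2 / N ^+ 2 * (N * (x * (1 - x))) <= e / 2.
  have -> : K * b ^+ 2 / N ^+ 2 * (N * (x * (1 - x))) =
      K * b ^+ 2 / N * (x * (1 - x)).
    by field; rewrite nat1r pnatr_eq0.
  have x1 : x * (1 - x) <= 1 by nra.
  apply: (@le_trans _ _ (K * b ^+ 2 / N)).
    by rewrite ler_piMr // divr_ge0 ?mulr_ge0 ?sqr_ge0 // ltW.
  move: nK; rewrite ltr_pdivrMr ?divr_gt0 // -/N => nK.
  by rewrite ler_pdivrMr // [leRHS]mulrC ltW.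
rewrite ler_distl; apply/andP; split.
  apply: (@le_trans _ _ (bernstein n.+1 (fun k => (phi t - e / 2) +
      - (K * b ^+ 2 / N ^+ 2) * (k%:R - N * x) ^+ 2)).[x]).
    rewrite bernstein_affine sq mulNr {1}(splitr e) opprD addrA.
    by rewrite lerD2l lerN2.
  apply: le_bernstein => // k kn; have := Fk k kn.
  by rewrite mulNr ler_distl opprD addrA => /andP[].
apply: (@le_trans _ _ (bernstein n.+1 (fun k => (phi t + e / 2) +
    (K * b ^+ 2 / N ^+ 2) * (k%:R - N * x) ^+ 2)).[x]).
  apply: le_bernstein => // k kn; have := Fk k kn.
  by rewrite ler_distl addrA => /andP[].
by rewrite bernstein_affine sq {2}(splitr e) addrA lerD2l.
Qed.

End Weierstrass.

(** * Inner product, norm and the Cauchy-Schwarz inequality *)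

Section Hilbert.
Variables (R : realType) (V : lmodType R[i]) (ip : V -> V -> R[i]).
Hypothesis ipP : is_inner_product ip.
Local Notation Re := (@complex.Re R).
Local Notation N := (vnorm ip).
Implicit Types (x y z : V) (A B P : V -> V).

Lemma ipDl x y z : ip (x + y) z = ip x z + ip y z.
Proof. by case: ipP => lin _ _ _; rewrite -[x]scale1r lin mul1r scale1r. Qed.

Lemma ip0l z : ip 0 z = 0.
Proof. by apply: (addrI (ip 0 z)); rewrite -ipDl !addr0. Qed.

Lemma ipZl a x z : ip (a *: x) z = a * ip x z.
Proof. by case: ipP => lin _ _ _; rewrite -[a *: x]addr0 lin ip0l addr0. Qed.

Lemma ipC x y : ip y x = ((ip x y)^*)%C.
Proof. by case: ipP. Qed.

Lemma ipDr x y z : ip z (x + y) = ip z x + ip z y.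
Proof. by rewrite ipC ipDl rmorphD /= -!ipC. Qed.

Lemma ipZr a x z : ip z (a *: x) = (a^*)%C * ip z x.
Proof. by rewrite ipC ipZl rmorphM /= -ipC. Qed.

Lemma ipNl x z : ip (- x) z = - ip x z.
Proof. by rewrite -scaleN1r ipZl mulN1r. Qed.

Lemma ipNr x z : ip z (- x) = - ip z x.
Proof. by rewrite ipC ipNl rmorphN /= -ipC. Qed.

Lemma ip_eq0 x : (forall z, ip z x = 0) -> x = 0.
Proof. by case: ipP => _ _ _ def /(_ x)/def. Qed.

Lemma Re_ipC x y : Re (ip y x) = Re (ip x y).
Proof. by rewrite ipC; case: (ip x y). Qed.

Lemma sqr_vnorm x : N x ^+ 2 = Re (ip x x).
Proof.
rewrite sqr_sqrtr //; case: ipP => _ _ /(_ x) + _.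
by case: (ip x x) => a b; rewrite lecE /= => /andP[].
Qed.

Lemma vnorm_ge0 x : 0 <= N x.
Proof. exact: sqrtr_ge0. Qed.

Lemma vnorm_eq0 x : N x = 0 -> x = 0.
Proof.
move=> x0; case: ipP => _ _ /(_ x) ge0 def; apply: def.
have : Re (ip x x) = 0 by rewrite -sqr_vnorm x0 expr0n.
move: ge0; case: (ip x x) => a b; rewrite lecE /= => /andP[/eqP-> _] ->.
by [].
Qed.

Lemma sqr_vnormD x y : N (x + y) ^+ 2 = N x ^+ 2 + 2 * Re (ip x y) + N y ^+ 2.
Proof.
by rewrite !sqr_vnorm !(ipDl, ipDr) !raddfD /= (Re_ipC x y); ring.
Qed.

Lemma sqr_cabs (c : R[i]) : (cabs c ^+ 2)%:C%C = c * (c^*)%C.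
Proof.
rewrite /cabs normc_def /= sqr_sqrtr ?addr_ge0 ?sqr_ge0 //.
case: c => a b; apply/eqP; rewrite eq_complex /=.
by apply/andP; split; apply/eqP; ring.
Qed.

Lemma cabs_ge0 (c : R[i]) : 0 <= cabs c.
Proof. by rewrite /cabs normc_def /= sqrtr_ge0. Qed.

Lemma normc_cabs (c : R[i]) : `|c| = (cabs c)%:C%C.
Proof. by rewrite /cabs normc_def. Qed.

Lemma cabsD (c d : R[i]) : cabs (c + d) <= cabs c + cabs d.
Proof. by rewrite -lecR rmorphD /= -!normc_cabs ler_normD. Qed.

Lemma vnormZ a x : N (a *: x) = cabs a * N x.
Proof.
apply/eqP; rewrite -(eqrXn2 (n := 2)) ?mulr_ge0 ?vnorm_ge0 ?cabs_ge0 //.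
rewrite exprMn !sqr_vnorm ipZl ipZr mulrA -sqr_cabs.
by case: (ip x x) => u v /=; rewrite mul0r subr0.
Qed.

Lemma cabs_real (r : R) : cabs (r%:C)%C = `|r|.
Proof. by rewrite /cabs normc_def /= expr0n addr0 sqrtr_sqr. Qed.

Lemma vnormZr (r : R) x : N ((r%:C)%C *: x) = `|r| * N x.
Proof. by rewrite vnormZ cabs_real. Qed.

Lemma vnormN x : N (- x) = N x.
Proof. by rewrite /vnorm ipNl ipNr opprK. Qed.

Lemma vnorm0 : N 0 = 0.
Proof. by rewrite /vnorm ip0l sqrtr0. Qed.

(** Expand the square of the norm of [N y x - N x y], which is nonnegative, and cancel [N x N y]. *)
Lemma Re_ip_le x y : Re (ip x y) <= N x * N y.
Proof.
have [x0|x0] := eqVneq (N x) 0.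
  by rewrite (vnorm_eq0 _ x0) ip0l vnorm0 mul0r.
have [y0|y0] := eqVneq (N y) 0.
  by rewrite (vnorm_eq0 _ y0) Re_ipC ip0l vnorm0 mulr0.
have px : 0 < N x by rewrite lt_def x0 vnorm_ge0.
have py : 0 < N y by rewrite lt_def y0 vnorm_ge0.
have := sqr_ge0 (N (((N y)%:C)%C *: x + - (((N x)%:C)%C *: y))).
rewrite sqr_vnormD vnormN !vnormZr !ger0_norm ?vnorm_ge0 //.
rewrite ipNr ipZl ipZr.
have -> : Re (- ((N y)%:C%C * (((N x)%:C)^*%C * ip x y))) =
    - (N x * N y * Re (ip x y)).
  by case: (ip x y) => u v /=; ring.
move=> H; rewrite -(ler_pM2l (mulr_gt0 px py)); nra.
Qed.

(** Multiplying [x] by the conjugate of [c = ip x y] makes the inner product the real number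
    [cabs c ^+ 2]; the bound on real parts then applies. *)
Lemma cauchy_schwarz x y : cabs (ip x y) <= N x * N y.
Proof.
set c := ip x y; have := cabs_ge0 c; rewrite le_eqVlt => /predU1P[<-|c0].
  by rewrite mulr_ge0 ?vnorm_ge0.
rewrite -(ler_pM2l c0) -expr2.
have -> : cabs c ^+ 2 = Re (ip ((c^*)%C *: x) y).
  by rewrite ipZl mulrC -sqr_cabs.
apply: le_trans (Re_ip_le _ _) _; rewrite vnormZ mulrA.
by rewrite /cabs !normc_def; case: c {c0} => a b /=; rewrite sqrrN.
Qed.

Lemma vnormD x y : N (x + y) <= N x + N y.
Proof.
rewrite -ler_sqr ?nnegrE ?addr_ge0 ?vnorm_ge0 // sqr_vnormD.
by have := Re_ip_le x y; lra.
Qed.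

(** * Bounded operators and the operator norm *)

Section BoundedLinear.
Variable A : V -> V.
Hypothesis bA : bounded_linear ip A.

Lemma blD x y : A (x + y) = A x + A y.
Proof. by case: bA => lin _; rewrite -[x]scale1r lin !scale1r. Qed.

Lemma bl0 : A 0 = 0.
Proof. by apply: (addrI (A 0)); rewrite -blD !addr0. Qed.

Lemma blZ a x : A (a *: x) = a *: A x.
Proof. by case: bA => lin _; rewrite -[a *: x]addr0 lin bl0 addr0. Qed.

Lemma blB x y : A (x - y) = A x - A y.
Proof. by rewrite blD -scaleN1r blZ scaleN1r. Qed.

Lemma opnorm_has_sup :
  has_sup [set N (A x) | x in [set x : V | N x <= 1]].
Proof.
split; first by exists (N (A 0)), 0 => //=; rewrite vnorm0.
case: bA => _ [M MP]; exists `|M| => _ [x /= x1 <-].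
apply: le_trans (MP x) _; apply: le_trans (ler_norm _) _.
by rewrite normrM (ger0_norm (vnorm_ge0 x)) ler_piMr.
Qed.

Lemma opnorm_ge x : N x <= 1 -> N (A x) <= opnorm ip A.
Proof. by move=> x1; apply: sup_upper_bound opnorm_has_sup _ _; exists x. Qed.

Lemma opnorm_ge0 : 0 <= opnorm ip A.
Proof.
by apply: le_trans (vnorm_ge0 (A 0)) _; apply: opnorm_ge; rewrite vnorm0.
Qed.

Lemma vnorm_normalize x : N x != 0 -> N (((N x)^-1)%:C%C *: x) = 1.
Proof.
by move=> x0; rewrite vnormZr ger0_norm ?invr_ge0 ?vnorm_ge0 // mulVf.
Qed.

Lemma le_opnorm x : N (A x) <= opnorm ip A * N x.
Proof.
have [x0|x0] := eqVneq (N x) 0.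
  by rewrite (vnorm_eq0 _ x0) bl0 vnorm0 mulr0.
have := opnorm_ge (((N x)^-1)%:C%C *: x).
rewrite vnorm_normalize // => /(_ (lexx _)).
rewrite blZ vnormZr ger0_norm ?invr_ge0 ?vnorm_ge0 // mulrC.
by rewrite ler_pdivrMr // lt_def x0 vnorm_ge0.
Qed.

(** The supremum runs over the closed unit ball; normalising a nonzero near-maximiser can only
    increase the norm of its image. *)
Lemma opnorm_unit e : (exists x : V, x <> 0) -> 0 < e ->
  exists2 x, N x = 1 & opnorm ip A - e < N (A x).
Proof.
move=> [u u0] e0; have [_ [x /= x1 <-] Ax] := sup_adherent e0 opnorm_has_sup.
have [x0|x0] := eqVneq (N x) 0; last first.
  exists (((N x)^-1)%:C%C *: x); first exact: vnorm_normalize.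
  rewrite blZ vnormZr ger0_norm ?invr_ge0 ?vnorm_ge0 //.
  apply: lt_le_trans Ax _; rewrite ler_peMl ?vnorm_ge0 // invf_ge1 //.
  by rewrite lt_def x0 vnorm_ge0.
(* If the near-maximiser is 0, then [opnorm ip A < e] and any unit vector serves. *)
have Nu : N u != 0 by apply/eqP => /vnorm_eq0.
exists (((N u)^-1)%:C%C *: u); first exact: vnorm_normalize.
by apply: lt_le_trans Ax _; rewrite (vnorm_eq0 _ x0) bl0 vnorm0 vnorm_ge0.
Qed.

End BoundedLinear.

Lemma bounded_linearD A B : bounded_linear ip A -> bounded_linear ip B ->
  bounded_linear ip (fun x => A x + B x).
Proof.
move=> bA bB; split=> [a x y|].
  by case: bA bB => linA _ [linB _]; rewrite linA linB scalerDr addrACA.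
exists (opnorm ip A + opnorm ip B) => x; rewrite mulrDl.
by apply: le_trans (vnormD _ _) _; apply: lerD; exact: le_opnorm.
Qed.

Lemma bounded_linearZ c A : bounded_linear ip A ->
  bounded_linear ip (fun x => c *: A x).
Proof.
move=> bA; split=> [a x y|].
  by case: bA => linA _; rewrite linA scalerDr !scalerA mulrC.
exists (cabs c * opnorm ip A) => x; rewrite vnormZ -mulrA.
by rewrite ler_wpM2l ?cabs_ge0 ?le_opnorm.
Qed.

Lemma bounded_linear_comp A B : bounded_linear ip A -> bounded_linear ip B ->
  bounded_linear ip (fun x => A (B x)).
Proof.
move=> bA bB; split=> [a x y|].
  by case: bA bB => linA _ [linB _]; rewrite linB linA.
exists (opnorm ip A * opnorm ip B) => x; apply: le_trans (le_opnorm _ bA _) _.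
by rewrite -mulrA ler_wpM2l ?opnorm_ge0 ?le_opnorm.
Qed.

Lemma bounded_linear0 : bounded_linear ip (fun=> 0).
Proof.
split=> [a x y|]; first by rewrite scaler0 addr0.
by exists 0 => x; rewrite vnorm0 mul0r.
Qed.

Lemma bounded_linear_id : bounded_linear ip id.
Proof. by split=> //; exists 1 => x; rewrite mul1r. Qed.

Lemma bounded_linear_iter P i : bounded_linear ip P ->
  bounded_linear ip (iter i P).
Proof.
move=> bP; elim: i => [|i IH]; first exact: bounded_linear_id.
exact: bounded_linear_comp.
Qed.

Lemma bounded_linear_poly_op p P : bounded_linear ip P ->
  bounded_linear ip (poly_op p P).
Proof.
move=> bP; rewrite /poly_op.
(* Induction on the list of indices with [p] fixed, as the index type depends on [size p]. *)
elim: (index_enum _) => [|i s IH].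
  by under eq_fun do rewrite big_nil; exact: bounded_linear0.
under eq_fun do rewrite big_cons.
by apply: bounded_linearD => //; apply/bounded_linearZ/bounded_linear_iter.
Qed.

(** * Adjoints *)

Section Adjoint.
Variables A Aadj : V -> V.
Hypotheses (bA : bounded_linear ip A) (adj : is_adjoint ip A Aadj).

(** [N (Aadj y) ^+ 2] is the real part of [ip (A (Aadj y)) y]; apply Cauchy-Schwarz and cancel one
    factor [N (Aadj y)]. *)
Lemma vnorm_adjoint y : N (Aadj y) <= opnorm ip A * N y.
Proof.
have := vnorm_ge0 (Aadj y); rewrite le_eqVlt => /predU1P[<-|y0].
  by rewrite mulr_ge0 ?vnorm_ge0 ?opnorm_ge0.
rewrite -(ler_pM2l y0) -expr2 sqr_vnorm -adj.
apply: le_trans (Re_ip_le _ _) _; rewrite mulrA ler_wpM2r ?vnorm_ge0 //.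
by rewrite mulrC le_opnorm.
Qed.

Lemma bounded_linear_adjoint : bounded_linear ip Aadj.
Proof.
split=> [a x y|]; last by exists (opnorm ip A); exact: vnorm_adjoint.
apply/subr0_eq/ip_eq0 => z.
by rewrite !(ipDr, ipNr, ipZr) -!adj !(ipDr, ipZr) subrr.
Qed.

Lemma Re_ip_adjoint x : Re (ip (Aadj (A x)) x) = N (A x) ^+ 2.
Proof. by rewrite Re_ipC -adj sqr_vnorm. Qed.

End Adjoint.

(** * Approximate eigenvectors and the functional calculus *)

(** The sequence is a parameter, so that one [u] can serve several operators at once; that its terms
    are unit vectors is assumed separately. *)
Definition approx_eigen (u : nat -> V) B (mu : R) :=
  (fun n => N (B (u n) - (mu%:C)%C *: u n)) @ \oo --> (0 : R).

Section ApproxEigen.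
Variable u : nat -> V.
Hypothesis u1 : forall n, N (u n) = 1.

Lemma cvg0_squeeze (v w : nat -> R) : (forall n, 0 <= v n <= w n) ->
  w @ \oo --> (0 : R) -> v @ \oo --> (0 : R).
Proof.
move=> vw w0; apply: (squeeze_cvgr _ (cvg_cst 0) w0).
by near=> n; exact: vw.
Unshelve. all: by end_near. Qed.

Lemma approx_eigenD A B a b : approx_eigen u A a -> approx_eigen u B b ->
  approx_eigen u (fun x => A x + B x) (a + b).
Proof.
move=> ua ub; apply: (cvg0_squeeze _ (fun n =>
    N (A (u n) - (a%:C)%C *: u n) + N (B (u n) - (b%:C)%C *: u n))).
  move=> n; rewrite vnorm_ge0 /= rmorphD scalerDl opprD addrACA.
  exact: vnormD.
by rewrite -[0 in X in _ --> X](addr0 0); apply: cvgD.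
Qed.

Lemma approx_eigenZ c A a : approx_eigen u A a ->
  approx_eigen u (fun x => (c%:C)%C *: A x) (c * a).
Proof.
move=> ua; apply: (cvg0_squeeze _ (fun n =>
    `|c| * N (A (u n) - (a%:C)%C *: u n))).
  by move=> n; rewrite vnorm_ge0 /= rmorphM -scalerA -scalerBr vnormZr.
by rewrite -[0 in X in _ --> X](mulr0 `|c|); apply: cvgM => //; exact: cvg_cst.
Qed.

Lemma approx_eigen_iter P mu i : bounded_linear ip P ->
  approx_eigen u P mu -> approx_eigen u (iter i P) (mu ^+ i).
Proof.
move=> bP uP; elim: i => [|i IH].
  apply: (cvg0_squeeze _ (fun=> 0)); last exact: cvg_cst.
  by move=> n; rewrite expr0 scale1r subrr vnorm0 lexx.
apply: (cvg0_squeeze _ (fun n =>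
    opnorm ip P * N (iter i P (u n) - ((mu ^+ i)%:C)%C *: u n) +
   `|mu ^+ i| * N (P (u n) - (mu%:C)%C *: u n))).
  move=> n; rewrite vnorm_ge0 /=.
  have -> : P (iter i P (u n)) - ((mu ^+ i.+1)%:C)%C *: u n =
    P (iter i P (u n) - ((mu ^+ i)%:C)%C *: u n) +
    ((mu ^+ i)%:C)%C *: (P (u n) - (mu%:C)%C *: u n).
    rewrite (blB _ bP) (blZ _ bP) scalerBr scalerA -rmorphM /= -exprSr.
    by rewrite addrA subrK.
  apply: le_trans (vnormD _ _) _; apply: lerD; first exact: le_opnorm.
  by rewrite vnormZr.
rewrite -[0 in X in _ --> X](addr0 0).
rewrite -{1}[0 in X in _ --> X](mulr0 (opnorm ip P)).
rewrite -[0 in X in _ --> _ + X](mulr0 `|mu ^+ i|).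
by apply: cvgD; apply: cvgM => //; exact: cvg_cst.
Qed.

Lemma approx_eigen_poly_op p P mu : bounded_linear ip P ->
  approx_eigen u P mu -> approx_eigen u (poly_op p P) p.[mu].
Proof.
move=> bP uP; rewrite horner_coef /poly_op.
elim: (index_enum _) => [|i s IH].
  apply: (cvg0_squeeze _ (fun=> 0)); last exact: cvg_cst.
  by move=> n; rewrite !big_nil scale0r subrr vnorm0 lexx.
rewrite big_cons; under eq_fun do rewrite big_cons.
exact: (approx_eigenD _ _ _ _
  (approx_eigenZ p`_i _ _ (approx_eigen_iter P mu i bP uP)) IH).
Qed.

(** Compare [mu] with the norm of [B (u n)]. Besides giving the final lower bound on a norm, this
    places [mu] in the interval on which [is_funcalc] compares polynomials with [phi]. *)
Lemma approx_eigen_le B mu : bounded_linear ip B -> approx_eigen u B mu ->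
  mu <= opnorm ip B.
Proof.
move=> bB uB; apply/ler_addgt0Pr => e e0.
have /cvgr0_norm_lt/(_ e e0) := uB => -[n _ /(_ n (leqnn n)) /=].
rewrite ger0_norm ?vnorm_ge0 // => lte.
have := vnormD (B (u n)) (- (B (u n) - (mu%:C)%C *: u n)).
rewrite vnormN opprB addrCA subrr addr0 vnormZr u1 mulr1 => mule.
have := le_opnorm B bB (u n); have := ler_norm mu; rewrite u1; lra.
Qed.

(** With a polynomial [p] within [e / 3] of [phi], three errors arise: [p(P)] against [B], bounded
    through [is_funcalc]; [p(P)] against [p.[mu]] on [u n], eventually small; and [p.[mu]] against
    [phi mu]. *)
Lemma approx_eigen_funcalc phi P B mu :
  {within [set t : R | 0 <= t], continuous phi} -> 0 <= mu ->
  bounded_linear ip P -> is_funcalc ip phi P B ->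
  approx_eigen u P mu -> approx_eigen u B (phi mu).
Proof.
move=> cphi mu0 bP [bB PB] uP; have muP := approx_eigen_le P mu bP uP.
apply/cvgr0Pnorm_le => e e0.
have b0 := opnorm_ge0 P bP.
have cphi' : {within `[0, opnorm ip P], continuous phi}.
  by apply: continuous_subspaceW cphi => t /=; rewrite in_itv => /andP[].
have [|p pP] := weierstrass _ phi _ (e / 3) b0 cphi'; first by rewrite divr_gt0.
have e3 : 0 < e / 3 by rewrite divr_gt0.
have /cvgr0_norm_lt/(_ _ e3) := approx_eigen_poly_op p P mu bP uP.
apply: filterS => n; rewrite !ger0_norm ?vnorm_ge0 // => ple.
have bPB : bounded_linear ip (fun x => poly_op p P x - B x).
  have /(bounded_linearD _ _ (bounded_linear_poly_op p P bP)) :=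
    bounded_linearZ (-1) B bB.
  by under eq_fun do rewrite scaleN1r.
have PBe : N (poly_op p P (u n) - B (u n)) <= e / 3.
  apply: le_trans (opnorm_ge _ bPB (u n) _) _; first by rewrite u1.
  apply: le_trans (PB p) _; apply: ge_sup.
    by exists `|p.[0] - phi 0|, 0 => //=; rewrite in_itv /= lexx.
  by move=> _ [t tb <-]; exact: pP.
have -> : B (u n) - ((phi mu)%:C)%C *: u n =
   - (poly_op p P (u n) - B (u n)) +
   ((poly_op p P (u n) - (p.[mu]%:C)%C *: u n) +
    ((p.[mu] - phi mu)%:C)%C *: u n).
  by rewrite rmorphB scalerBl opprB !addrA !subrK.
apply: le_trans (vnormD _ _) _; rewrite vnormN.
have := vnormD (poly_op p P (u n) - (p.[mu]%:C)%C *: u n)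
  (((p.[mu] - phi mu)%:C)%C *: u n).
rewrite vnormZr u1 mulr1.
have : `|p.[mu] - phi mu| <= e / 3 by apply: pP; rewrite in_itv /= mu0.
lra.
Qed.

End ApproxEigen.

(** Choose unit vectors with [N (A (u n))] within [1 / (n + 1)] of [a]. Expanding the squared error
    and using [N (Aadj (A (u n))) <= a ^+ 2] bounds it by [2 a ^+ 2 (a ^+ 2 - N (A (u n)) ^+ 2)],
    and the last factor is at most [2 a / (n + 1)]. *)
Lemma approx_eigen_gram A Aadj : (exists x : V, x <> 0) ->
  bounded_linear ip A -> is_adjoint ip A Aadj ->
  exists2 u : nat -> V, forall n, N (u n) = 1 &
    approx_eigen u (fun x => Aadj (A x)) (opnorm ip A ^+ 2).
Proof.
move=> V0 bA adj; set a := opnorm ip A; have a0 : 0 <= a := opnorm_ge0 A bA.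
have /choice[u uP] n : exists x, N x = 1 /\ a - (n.+1%:R)^-1 < N (A x).
  have [|x] := opnorm_unit A bA (n.+1%:R)^-1 V0; first by rewrite invr_gt0.
  by exists x.
have u1 n : N (u n) = 1 by case: (uP n).
exists u => //.
have bnd n : N (Aadj (A (u n)) - ((a ^+ 2)%:C)%C *: u n) ^+ 2 <=
    4 * a ^+ 3 * (n.+1%:R)^-1.
  rewrite sqr_vnormD vnormN vnormZr u1 mulr1 ipNr ipZr.
  have -> : Re (- (((a ^+ 2)%:C)^*%C * ip (Aadj (A (u n))) (u n))) =
      - (a ^+ 2 * N (A (u n)) ^+ 2).
    by rewrite -(Re_ip_adjoint A Aadj adj); case: (ip _ _) => r s /=; ring.
  rewrite real_normK ?num_real //.
  have Au := opnorm_ge A bA (u n); rewrite u1 lexx -/a in Au.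
  have h1 := Au isT; have h2 : N (Aadj (A (u n))) <= a ^+ 2.
    apply: le_trans (vnorm_adjoint _ _ bA adj _) _.
    by rewrite -/a expr2 ler_wpM2l.
  have h3 : N (Aadj (A (u n))) ^+ 2 <= (a ^+ 2) ^+ 2.
    by rewrite ler_sqr ?nnegrE ?vnorm_ge0 ?sqr_ge0.
  have [_ h4] := uP n; have h5 := vnorm_ge0 (A (u n)).
  set w := N (A (u n)) in h1 h4 h5 *; set d := n.+1%:R^-1 in h4 *.
  have h6 : a ^+ 2 - w ^+ 2 <= 2 * a * d.
    have -> : a ^+ 2 - w ^+ 2 = (a + w) * (a - w) by ring.
    by apply: ler_pM; lra.
  have : 2 * a ^+ 2 * (a ^+ 2 - w ^+ 2) <= 2 * a ^+ 2 * (2 * a * d).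
    by apply: ler_wpM2l => //; rewrite mulr_ge0 ?sqr_ge0.
  lra.
pose v n := N (Aadj (A (u n)) - ((a ^+ 2)%:C)%C *: u n).
(* The bound concerns squares; continuity of the square root at 0 carries it to the norms. *)
suff : (fun n => Num.sqrt (v n ^+ 2)) @ \oo --> Num.sqrt (0 : R).
  rewrite sqrtr0; under eq_fun do rewrite sqrtr_sqr ger0_norm ?vnorm_ge0 //.
  by [].
apply: (@cvg_comp _ _ _ (fun n => v n ^+ 2) Num.sqrt _ (nbhs (0 : R)));
  last exact: sqrt_continuous.
apply: (cvg0_squeeze _ (fun n => 4 * a ^+ 3 * (n.+1%:R)^-1)).
  by move=> n; rewrite sqr_ge0 bnd.
rewrite -[0 in X in _ --> X](mulr0 (4 * a ^+ 3)).
by apply: cvgM; [exact: cvg_cst | exact: cvg_harmonic].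
Qed.

End Hilbert.

(** * Continuity of the scalar functions *)

Lemma continuous_within_sqr (R : realType) (S : set R) (f : R -> R) :
  {within S, continuous f} -> {within S, continuous (fun t => f t ^+ 2)}.
Proof. by move=> cf t; apply: cvgM; exact: cf. Qed.

(* On [0, b] convexity bounds the slopes of [h] by [h (b + 1)]; monotonicity
   excludes the jump that a convex function may have at 0. *)
Lemma convex_nondecreasing_continuous (R : realType) (h : R -> R) :
  nonneg_on_pos h -> nondecreasing_on_pos h -> convex_on_pos h ->
  {within [set t : R | 0 <= t], continuous h}.
Proof.
move=> h0 hnd hcvx.
have lip b s t : 0 <= s -> s <= t -> t <= b ->
    `|h s - h t| <= h (b + 1) * `|s - t|.
  move=> s0 st tb; rewrite distrC (distrC s) !ger0_norm ?subr_ge0 ?hnd //.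
  (* [t] is the convex combination of [s] and [b + 1] with weight [l] on [b + 1]; the denominator is
     at least 1, whence [l <= t - s]. *)
  set l := (t - s) / (b + 1 - s).
  have bs : 0 < b + 1 - s by lra.
  have l0 : 0 <= l by apply: divr_ge0; lra.
  have lts : l <= t - s by rewrite ler_pdivrMr // ler_peMr; lra.
  have l1 : l <= 1 by rewrite ler_pdivrMr //; lra.
  have := hcvx s (b + 1) (1 - l) s0.
  have -> : (1 - l) * s + (1 - (1 - l)) * (b + 1) = t.
    by rewrite /l; field; rewrite gt_eqF.
  have b0 : 0 <= b + 1 by lra.
  have hl : l * h (b + 1) <= (t - s) * h (b + 1) by rewrite ler_wpM2r ?h0.
  have hs : 0 <= l * h s by rewrite mulr_ge0 ?h0.
  move=> /(_ b0) H; have := H _ _; rewrite subr_ge0 => /(_ l1).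
  by rewrite gerBl => /(_ l0); lra.
apply/subspace_continuousP => x /= x0; apply/cvgrPdist_le => e e0.
(* The Lipschitz bound is taken with [b = x + 1]; the added 1 keeps the divisor positive when [h]
   vanishes there. *)
have hb : 0 < h (x + 1 + 1) + 1 by have := h0 (x + 1 + 1); lra.
rewrite near_withinE; near=> y => /= y0.
have xy : `|x - y| < e / (h (x + 1 + 1) + 1).
  by near: y; apply: (@nbhsx_ballx R R); rewrite divr_gt0.
have xy1 : `|x - y| < 1 by near: y; apply: (@nbhsx_ballx R R).
have yb : y <= x + 1 by have := ler_norm (y - x); rewrite distrC; lra.
have xb : x <= x + 1 by rewrite lerDl.
have : `|h x - h y| <= h (x + 1 + 1) * `|x - y|.
  have [le|/ltW le] := leP x y; first exact: lip.
  by rewrite distrC (distrC x); apply: lip.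
move: xy; rewrite ltr_pdivlMr //; have := normr_ge0 (x - y); lra.
Unshelve. all: by end_near. Qed.

(** * The estimate for one diagonal block *)

Lemma le_opnorm_funcalc_sum (R : realType) (V : lmodType R[i])
  (ip : V -> V -> R[i]) (A Aadj absA fA gA hfA hgA : V -> V) (f g h : R -> R) :
  is_inner_product ip -> (exists x : V, x <> 0) ->
  bounded_linear ip A -> is_adjoint ip A Aadj ->
  {within [set t : R | 0 <= t], continuous f} ->
  {within [set t : R | 0 <= t], continuous g} ->
  (forall t : R, 0 <= t -> f t * g t = t) ->
  nonneg_on_pos h -> nondecreasing_on_pos h -> convex_on_pos h ->
  is_funcalc ip Num.sqrt (fun x => Aadj (A x)) absA ->
  is_funcalc ip (fun t => f t ^+ 2) absA fA ->
  is_funcalc ip (fun t => g t ^+ 2) absA gA ->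
  is_funcalc ip h fA hfA -> is_funcalc ip h gA hgA ->
  h (opnorm ip A) <= 2^-1 * opnorm ip (fun x => hfA x + hgA x).
Proof.
move=> ipP V0 bA adj cf cg fg h0 hnd hcvx absP fP gP hfP hgP.
set a := opnorm ip A; have a0 : 0 <= a := opnorm_ge0 _ _ _ ipP A bA.
have [u u1 uP] := approx_eigen_gram _ _ _ ipP A Aadj V0 bA adj.
have bP : bounded_linear ip (fun x => Aadj (A x)).
  exact: bounded_linear_comp (bounded_linear_adjoint _ _ _ ipP _ _ bA adj) bA.
have ch := convex_nondecreasing_continuous _ _ h0 hnd hcvx.
have csqrt : {within [set t : R | 0 <= t], continuous Num.sqrt}.
  by apply: continuous_subspaceT => t; exact: sqrt_continuous.
have := approx_eigen_funcalc _ _ _ ipP _ u1 _ _ _ _ csqrt (sqr_ge0 a) bP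
  absP uP.
rewrite sqrtr_sqr ger0_norm // => uabs.
have calc phi := approx_eigen_funcalc _ _ _ ipP _ u1 phi.
have ufA := calc _ _ _ _ (continuous_within_sqr _ _ _ cf) a0 absP.1 fP uabs.
have ugA := calc _ _ _ _ (continuous_within_sqr _ _ _ cg) a0 absP.1 gP uabs.
have uhf := calc _ _ _ _ ch (sqr_ge0 (f a)) fP.1 hfP ufA.
have uhg := calc _ _ _ _ ch (sqr_ge0 (g a)) gP.1 hgP ugA.
have usum := approx_eigenD _ _ _ ipP _ _ _ _ _ uhf uhg.
have le_sum := approx_eigen_le _ _ _ ipP _ u1 _ _
  (bounded_linearD _ _ _ ipP _ _ hfP.1 hgP.1) usum.
(* The weights are written as in [convex_on_pos] with [l = 2^-1], so that monotonicity and convexity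
   of [h] chain directly. *)
have amgm : a <= 2^-1 * f a ^+ 2 + (1 - 2^-1) * g a ^+ 2.
  by rewrite -{1}(fg a a0); have := sqr_ge0 (f a - g a); lra.
have := hcvx (f a ^+ 2) (g a ^+ 2) 2^-1 (sqr_ge0 _) (sqr_ge0 _).
have := hnd _ _ a0 amgm; lra.
Qed.

(** * The numerical radius and the conclusion *)

(** Cauchy-Schwarz on each block bounds the form by the maximum times [N x ^+ 2 + N y ^+ 2 = 1]. The
    lower bound 0 is there because [h] is monotone only on the half-line. *)
Lemma numrad_diag_le (R : realType) (V : lmodType R[i])
  (ip : V -> V -> R[i]) (A D : V -> V) :
  is_inner_product ip -> (exists x : V, x <> 0) ->
  bounded_linear ip A -> bounded_linear ip D ->
  0 <= numrad_diag ip A D <= Num.max (opnorm ip A) (opnorm ip D).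
Proof.
move=> ipP [v v0] bA bD.
set w := [set cabs (ip (A xy.1) xy.1 + ip (D xy.2) xy.2) |
  xy in [set xy : V * V | vnorm ip xy.1 ^+ 2 + vnorm ip xy.2 ^+ 2 = 1]].
have ubw : ubound w (Num.max (opnorm ip A) (opnorm ip D)).
  move=> _ [[x y] /= xy1 <-]; apply: le_trans (cabsD _ _ _) _.
  rewrite -[leRHS]mulr1 -xy1 mulrDr; apply: lerD.
    apply: le_trans (cauchy_schwarz _ _ _ ipP _ _) _.
    rewrite expr2 mulrA ler_wpM2r ?vnorm_ge0 //.
    apply: le_trans (le_opnorm _ _ _ ipP _ bA _) _.
    by rewrite ler_wpM2r ?vnorm_ge0 // le_max lexx.
  apply: le_trans (cauchy_schwarz _ _ _ ipP _ _) _.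
  rewrite expr2 mulrA ler_wpM2r ?vnorm_ge0 //.
  apply: le_trans (le_opnorm _ _ _ ipP _ bD _) _.
  by rewrite ler_wpM2r ?vnorm_ge0 // le_max lexx orbT.
have [c wc] : w !=set0.
  have v1 : vnorm ip v != 0 by apply/eqP => /(vnorm_eq0 _ _ _ ipP).
  eexists; exists (((vnorm ip v)^-1)%:C%C *: v, 0) => /=; last by [].
  rewrite (vnorm_normalize _ _ _ ipP _ v1) (vnorm0 _ _ _ ipP).
  by rewrite expr1n expr0n addr0.
apply/andP; split; last by apply: ge_sup => //; exists c.
apply: (@le_trans _ _ c); first by case: wc => z _ <-; exact: cabs_ge0.
by apply: ub_le_sup => //; exists (Num.max (opnorm ip A) (opnorm ip D)).
Qed.

Theorem theorem3p1 (R : realType) (V : lmodType R[i]) (ip : V -> V -> R[i])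
  (HV : is_Hilbert ip) (HV0 : exists x : V, x <> 0)
  (A D Aadj Dadj : V -> V)
  (hA : bounded_linear ip A) (hD : bounded_linear ip D)
  (hAadj : is_adjoint ip A Aadj) (hDadj : is_adjoint ip D Dadj)
  (f g h : R -> R)
  (f_cont : {within [set t : R | 0 <= t], continuous f})
  (g_cont : {within [set t : R | 0 <= t], continuous g})
  (f_ge0 : nonneg_on_pos f) (g_ge0 : nonneg_on_pos g)
  (fg : forall t : R, 0 <= t -> f t * g t = t)
  (h_ge0 : nonneg_on_pos h) (h_nd : nondecreasing_on_pos h)
  (h_cvx : convex_on_pos h)
  (* |A| and |D| *)
  (absA absD : V -> V)
  (habsA : is_funcalc ip Num.sqrt (fun x => Aadj (A x)) absA)
  (habsD : is_funcalc ip Num.sqrt (fun x => Dadj (D x)) absD)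
  (* f^2(|A|), g^2(|A|), f^2(|D|), g^2(|D|) *)
  (fA gA fD gD : V -> V)
  (hfA : is_funcalc ip (fun t => f t ^+ 2) absA fA)
  (hgA : is_funcalc ip (fun t => g t ^+ 2) absA gA)
  (hfD : is_funcalc ip (fun t => f t ^+ 2) absD fD)
  (hgD : is_funcalc ip (fun t => g t ^+ 2) absD gD)
  (* h(f^2(|A|)), h(g^2(|A|)), h(f^2(|D|)), h(g^2(|D|)) *)
  (hfA' hgA' hfD' hgD' : V -> V)
  (hhfA : is_funcalc ip h fA hfA') (hhgA : is_funcalc ip h gA hgA')
  (hhfD : is_funcalc ip h fD hfD') (hhgD : is_funcalc ip h gD hgD') :
  h (numrad_diag ip A D) <=
    2^-1 * Num.max (opnorm ip (fun x => hfA' x + hgA' x))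
                   (opnorm ip (fun x => hfD' x + hgD' x)).
Proof.
have ipP := HV.1.
have /andP[w0 wle] := numrad_diag_le _ _ _ _ _ ipP HV0 hA hD.
apply: le_trans (h_nd _ _ w0 wle) _.
have leA := le_opnorm_funcalc_sum _ _ _ _ _ _ _ _ _ _ _ _ _ ipP HV0 hA hAadj
  f_cont g_cont fg h_ge0 h_nd h_cvx habsA hfA hgA hhfA hhgA.
have leD := le_opnorm_funcalc_sum _ _ _ _ _ _ _ _ _ _ _ _ _ ipP HV0 hD hDadj
  f_cont g_cont fg h_ge0 h_nd h_cvx habsD hfD hgD hhfD hhgD.
(* The larger of the two norms is one of them, and its own block's estimate concludes. *)
rewrite maxr_pMr ?invr_ge0 // le_max.
by case: (leP (opnorm ip A)) => _; rewrite ?leA ?leD ?orbT.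
Qed.
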